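(* Consider the \textsc{Normal Domination Game} and let $n\geq 3$. The nimber of the cycle $C_n$ is $1$ if $n \bmod 4 = 3$, and is $0$ otherwise. Consequently, Alice (the first player) wins the \textsc{Normal Domination Game} on $C_n$ if and only if $n \bmod 4 = 3$.
   Context: $C_n$ is the cycle on $n$ vertices. A vertex dominates itself and its neighbors. In the \textsc{Normal Domination Game} on a graph, Alice (first) and Bob alternately select playable vertices, where a vertex is playable if it dominates at least one vertex not dominated by previously selected vertices; the game ends when no vertex is playable, and the last player to move wins. The nimber (Sprague–Grundy value) of a position is the minimum excludant (least non-negative integer not in the set) of the nimbers of positions reachable in one move; a position with no moves has nimber $0$. *)

(* Defs.v *)
From mathcomp Require Import all_boot.

Set Implicit Arguments.
Unset Strict Implicit.
Unset Printing Implicit Defensive.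

Definition cycle_rel (n : nat) : rel 'I_n :=
  fun i j => (j == i.+1 %% n :> nat) || (i == j.+1 %% n :> nat).

Lemma cycle_rel_sym n : symmetric (@cycle_rel n).
Proof. by move=> i j; rewrite /cycle_rel orbC. Qed.

Lemma cycle_rel_irr n : 2 <= n -> irreflexive (@cycle_rel n).
Proof.
move=> n_ge2 i; rewrite /cycle_rel orbb; apply/negbTE.
have := ltn_ord i; rewrite leq_eqVlt => /predU1P[eq_n | lt_n].
  by rewrite eq_n modnn; apply: contraL n_ge2 => /eqP i0; rewrite -eq_n i0.
by rewrite modn_small // -{1}[val i]addn0 -addn1 eqn_add2l.
Qed.

Lemma mex_subproof (s : seq nat) : exists k, k \notin s.
Proof.
exists (sumn s).+1; apply: contraT; rewrite negbK => ss.
have le_sumn x : x \in s -> x <= sumn s.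
  elim: s {ss} => //= y s IHs; rewrite inE => /predU1P[-> | /IHs le_x].
    exact: leq_addr.
  exact: leq_trans le_x (leq_addl _ _).
by have := le_sumn _ ss; rewrite ltnn.
Qed.

Definition mex (s : seq nat) : nat := ex_minn (mex_subproof s).

Section DominationGame.

(* The graph is given by its adjacency relation e; a position of the game is
   the set S of the vertices selected so far. *)
Variables (T : finType) (e : rel T).
Implicit Types (u v w : T) (S : {set T}).

Definition dominates v u : bool := (u == v) || e v u.

Definition dominated S u : bool := [exists v in S, dominates v u].

Definition playable S v : bool :=
  [exists u, dominates v u && ~~ dominated S u].

Lemma playable_notin S v : playable S v -> v \notin S.
Proof.
case/existsP=> u /andP[dom_vu]; apply: contra => vS.
by apply/existsP; exists v; rewrite vS.
Qed.

(* Every move selects a new vertex, so #|~: S| bounds the number of remaining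
   moves; nimberE below is the defining equation. *)
Fixpoint nimber_rec (k : nat) S : nat :=
  if k is k'.+1 then mex [seq nimber_rec k' (v |: S) | v <- enum (playable S)]
  else 0.

Definition nimber S : nat := nimber_rec #|~: S| S.

Lemma nimberE S :
  nimber S = mex [seq nimber (v |: S) | v <- enum (playable S)].
Proof.
rewrite /nimber; case Dk: #|~: S| => [|k] /=.
  have /eq_enum-> : playable S =i pred0.
    move=> v; apply/negbTE/negP => /playable_notin; rewrite -in_setC.
    by rewrite (cards0_eq Dk) inE.
  rewrite enum0 /mex; case: ex_minnP => m _ /(_ 0 isT).
  by rewrite leqn0 => /eqP.
congr mex; apply/eq_in_map => v; rewrite mem_enum => /playable_notin vS.
congr nimber_rec; apply/eqP; rewrite -eqSS -Dk (cardsD1 v) inE vS.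
by rewrite setCU setIC -setDE.
Qed.

(* The player to move at S has a winning strategy: some move such that, after
   every reply of the opponent, the player again has a winning strategy.  If no
   reply exists, the player has made the last move and wins. *)
Inductive mover_wins S : Prop :=
  MoverWins v of playable S v &
    (forall w, playable (v |: S) w -> mover_wins (w |: (v |: S))).

Definition graph_nimber : nat := nimber set0.

Definition Alice_wins : Prop := mover_wins set0.

End DominationGame.

(* Main.v *)
Require Import Defs.
From mathcomp Require Import all_boot.
From mathcomp Require Import zify.

(** Once a vertex has been selected, the selected vertices cut the cycle into
    arcs.  Selecting a vertex strictly inside an arc of length [d] splits it
    into arcs of lengths [j] and [d - j], and this is a legal move exactly when
    [d > 3] (the arc then has [d - 3] undominated vertices).  The game is thus a
    sum of independent arcs, and by induction an arc of length [d] has nimber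
    [(d - 3) %% 4] (truncated subtraction), written below with its two binary
    digits; the nimber of a position is the bitwise sum over its arcs.  All
    first moves on [C_n] leave a single arc of length [n]. *)

(** * Mex and the winning criterion *)

Lemma mex_eq (s : seq nat) m :
  m \notin s -> (forall k, k < m -> k \in s) -> mex s = m.
Proof.
move=> ms ltm; rewrite /mex; case: ex_minnP => k ks mink.
apply/eqP; rewrite eqn_leq mink // leqNgt.
by apply: contra ks; apply: ltm.
Qed.

Lemma mex_eq0 (s : seq nat) : (mex s == 0) = (0 \notin s).
Proof.
rewrite /mex; case: ex_minnP => k ks mink; apply/eqP/idP => [<- //|/mink].
by rewrite leqn0 => /eqP.
Qed.

Section Outcome.

Variables (T : finType) (e : rel T).
Implicit Types (v w : T) (S : {set T}).

Lemma card_setC_playable S v : playable e S v -> #|~: (v |: S)| < #|~: S|.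
Proof.
move/playable_notin=> vS; rewrite setCU setIC -setDE.
by rewrite [X in _ < X](cardsD1 v) inE vS.
Qed.

Lemma nimber_eq0P S :
  reflect (forall v, playable e S v -> nimber e (v |: S) != 0)
          (nimber e S == 0).
Proof.
rewrite nimberE mex_eq0; apply: (iffP idP) => [n0 v pv|n0].
  apply: contra n0 => /eqP n0; apply/mapP; exists v; last by rewrite n0.
  by rewrite mem_enum.
apply/mapP => -[v]; rewrite mem_enum => pv Dv.
by have := n0 v pv; rewrite -Dv.
Qed.

(** By induction on the strategy, every reply to its move [v] leads to a nonzero nimber, so [v]
    moves to nimber 0. Conversely, a nonzero mex means that some move reaches nimber 0, and that
    move wins. *)
Lemma mover_winsP S : mover_wins e S <-> nimber e S != 0.
Proof.
split=> [|].
  elim=> {}S v pv _ IHS; apply: contraT; rewrite negbK => /nimber_eq0P.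
  by move=> /(_ v pv)/negP[]; apply/nimber_eq0P.
have [m] := ubnP #|~: S|; elim: m S => // m IHm S lt_m.
rewrite nimberE mex_eq0 negbK => /mapP[v]; rewrite mem_enum => pv /esym/eqP.
move/nimber_eq0P=> n0; apply: (MoverWins pv) => w pw; apply: IHm; last exact: n0.
have := card_setC_playable _ _ pv; have := card_setC_playable _ _ pw; lia.
Qed.

End Outcome.

(** * Arithmetic of arc values *)

Definition arc_bit0 d := odd (d - 3).
Definition arc_bit1 d := odd (d - 3)./2.

Lemma arc_bits d : (d - 3) %% 4 = arc_bit1 d * 2 + arc_bit0 d.
Proof. rewrite /arc_bit0 /arc_bit1; lia. Qed.

(** If one part is shorter than 3, it has value 0, and the truncated excess of the other is 1 or 2
    less than [d - 3]. Otherwise the two excesses add up to [d - 6], so the low digit alone already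
    differs. *)
Lemma arc_split_neq d j : 3 < d -> 0 < j < d ->
  arc_bit0 d = arc_bit0 j (+) arc_bit0 (d - j) ->
  arc_bit1 d = arc_bit1 j (+) arc_bit1 (d - j) -> False.
Proof.
rewrite /arc_bit0 /arc_bit1 => d3 jd.
have [j3|j3] := ltnP j 3; first have -> : j - 3 = 0 by lia.
  rewrite /=; lia.
have [dj3|dj3] := ltnP (d - j) 3; first have -> : d - j - 3 = 0 by lia.
  rewrite /= !addbF; lia.
move=> E0 _; move: E0; rewrite -oddD.
have -> : j - 3 + (d - j - 3) = d - 3 - 3 by lia.
lia.
Qed.

Lemma nat_of_bits_inj (a b c d : bool) :
  a * 2 + b = c * 2 + d -> a = c /\ b = d.
Proof. by case: a b c d => [] [] [] []. Qed.

(* The witness splits off an arc of length at most 3, whose nimber is 0. *)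
Lemma arc_split_lt d (t0 t1 : bool) : t1 * 2 + t0 < arc_bit1 d * 2 + arc_bit0 d ->
  exists2 j, 0 < j < d & arc_bit0 j (+) arc_bit0 (d - j) = t0 /\
                         arc_bit1 j (+) arc_bit1 (d - j) = t1.
Proof.
rewrite -arc_bits => lt_t; exists ((d - 3) %% 4 - (t1 * 2 + t0)); first by lia.
set j := _ - (_ + _).
have j3 : j - 3 = 0 by rewrite /j; lia.
rewrite {1}/arc_bit0 {1}/arc_bit1 j3 /=; apply/and_comm.
apply: nat_of_bits_inj; rewrite -arc_bits /j; lia.
Qed.

(** * Arcs between selected vertices *)

Section Arcs.

Variables (T : finType) (f : T -> T).
Hypotheses (f_inj : injective f) (f_conn : forall x y, fconnect f x y).

Implicit Types (u v w x : T) (S : {set T}).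

(** The cycle is given by a successor map [f] with a single orbit, so that walking along an arc is
    iteration and needs no modular arithmetic. *)
Let e : rel T := fun x y => (y == f x) || (x == f y).

Lemma arc_subproof S v : exists d, (0 < d) && ((v \in S) ==> (iter d f v \in S)).
Proof.
exists (order f v); rewrite order_gt0 iter_order //; exact: implybb.
Qed.

(* For [v \notin S] this has the junk value 1. *)
Definition arc S v := ex_minn (arc_subproof S v).

Lemma arcP S v : v \in S ->
  [/\ 0 < arc S v, iter (arc S v) f v \in S
    & forall i, 0 < i < arc S v -> iter i f v \notin S].
Proof.
rewrite /arc => vS; case: ex_minnP => d; rewrite vS => /andP[d0 dS] mind.
split=> // i /andP[i0 ltid]; apply: contraL ltid => iS.
by rewrite -leqNgt; apply: mind; rewrite i0.
Qed.

Lemma arc_eq S v d : v \in S -> 0 < d -> iter d f v \in S ->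
  (forall i, 0 < i < d -> iter i f v \notin S) -> arc S v = d.
Proof.
move=> vS d0 dS mind; have [a0 aS mina] := arcP S v vS.
apply/eqP; rewrite eqn_leq; apply/andP; split; rewrite leqNgt.
  by apply/negP => lt; have := mina d; rewrite d0 lt dS => /(_ isT).
by apply/negP => lt; have := mind (arc S v); rewrite a0 lt aS => /(_ isT).
Qed.

Lemma iter_inj i : injective (iter i f).
Proof. by elim: i => // i IHi x y /= /f_inj/IHi. Qed.

Lemma iter_eq_sub i j u v : i <= j -> iter i f u = iter j f v ->
  u = iter (j - i) f v.
Proof. by move=> ij; rewrite -{1}(subnKC ij) iterD => /iter_inj. Qed.

(** Take the [v] in [S] from which [w] is reached in the fewest steps: if the walk went as far as
    the end of the arc of [v], starting from that end would be shorter. *)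
Lemma arc_cover S w : S != set0 -> w \notin S ->
  exists v j, [/\ v \in S, 0 < j < arc S v & w = iter j f v].
Proof.
case/set0Pn=> u uS wS.
have exk : exists k, [exists v in S, iter k f v == w].
  exists (findex f u w); apply/existsP; exists u.
  by rewrite uS iter_findex ?eqxx.
case: (ex_minnP exk) => k /existsP[v /andP[vS /eqP Dw]] mink.
exists v, k; split=> //; have [a0 aS _] := arcP S v vS.
case: k Dw mink {exk} => [/= Dw _|k Dw mink].
  by rewrite -Dw vS in wS.
rewrite /= ltnNge; apply/negP => le_ak.
have /mink : [exists u in S, iter (k.+1 - arc S v) f u == w]; last by lia.
by apply/existsP; exists (iter (arc S v) f v); rewrite aS -iterD subnK ?Dw /=.
Qed.

(** * Effect of a move on the arcs *)

Section Split.

Variables (S : {set T}) (v : T) (j : nat).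
Hypotheses (vS : v \in S) (j_lt : 0 < j < arc S v).
Let d := arc S v.
Let w := iter j f v.

Lemma split_notin : w \notin S.
Proof. by have [_ _] := arcP S v vS; apply. Qed.

Lemma arc_split_left : arc (w |: S) v = j.
Proof.
have [a0 aS mina] := arcP S v vS; case/andP: (j_lt) => j0 jd.
apply: arc_eq; rewrite ?inE ?vS ?orbT ?eqxx // => i /andP[i0 ij].
rewrite !inE negb_or mina ?andbT; last by lia.
apply/eqP => /(iter_eq_sub _ _ _ _ (ltnW ij)) Dv.
by have := mina (j - i); rewrite -Dv vS => /(_ ltac:(lia)).
Qed.

Lemma arc_split_right : arc (w |: S) w = d - j.
Proof.
have [a0 aS mina] := arcP S v vS; case/andP: (j_lt) => j0 jd.
apply: arc_eq => [|||i /andP[i0 ij]]; rewrite /d ?subn_gt0 //.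
- by rewrite !inE eqxx.
- by rewrite -iterD subnK ?inE ?aS ?orbT // ltnW.
rewrite /d in ij.
rewrite !inE -iterD negb_or mina ?andbT; last by lia.
apply/eqP => /esym/(iter_eq_sub _ _ _ _ (leq_addl i j)) Dv.
by have := mina (i + j - j); rewrite -Dv vS => /(_ ltac:(lia)).
Qed.

(** If the arc of [u] met [w], going back from [w] would put [u] strictly inside the arc of [v], or
    [v] inside that of [u]. *)
Lemma arc_split_other u : u \in S -> u != v -> arc (w |: S) u = arc S u.
Proof.
move=> uS uv; have [a0 aS mina] := arcP S u uS; have [_ _ minv] := arcP S v vS.
case/andP: (j_lt) => j0 jd.
apply: arc_eq; rewrite ?inE ?uS ?aS ?orbT // => i /andP[i0 ij].
rewrite !inE negb_or mina ?i0 // andbT; apply/eqP => Dw.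
have [le_ij|lt_ji] := leqP i j.
  have Du := iter_eq_sub _ _ _ _ le_ij Dw.
  have [ij0|ij0] := posnP (j - i); first by rewrite Du ij0 eqxx in uv.
  by have := minv (j - i); rewrite -Du uS => /(_ ltac:(lia)).
have Dv := iter_eq_sub _ _ _ _ (ltnW lt_ji) (esym Dw).
by have := mina (i - j); rewrite -Dv vS => /(_ ltac:(lia)).
Qed.

(** Xor is its own inverse, so the term [g d] removes the old arc. An arbitrary [g] serves both
    digits. *)
Lemma arc_sum_split (g : nat -> bool) :
  \big[addb/false]_(u in w |: S) g (arc (w |: S) u) =
  (\big[addb/false]_(u in S) g (arc S u)) (+) (g d (+) (g j (+) g (d - j))).
Proof.
rewrite big_setU1 ?split_notin //= arc_split_right.
rewrite (bigD1 v) //= arc_split_left [X in _ = X (+) _](bigD1 v) //=.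
rewrite (eq_bigr (fun u => g (arc S u))); last first.
  by move=> u /andP[uS uv]; rewrite arc_split_other.
rewrite -/d.
by case: (\big[_/_]_(_ in _ | _) _) (g d) (g j) (g (d - j)) => [] [] [] [].
Qed.

(** A selected vertex dominating a vertex two or more steps from both ends would lie strictly inside
    the arc. *)
Lemma dominated_arc i : i <= d ->
  dominated e S (iter i f v) = (i < 2) || (d < i + 2).
Proof.
have [a0 aS mina] := arcP S v vS => id; rewrite -/d in a0 aS mina.
apply/existsP/idP => [[u /andP[uS]]|].
  move=> dom; apply: contraT; rewrite negb_or -!leqNgt => /andP[i2 i2d].
  have notS k : 0 < k < d -> iter k f v != u.
    by move/mina; apply: contraNneq => ->.
  case/or3P: dom => [/eqP Du|/eqP Du|/eqP Du].
  - by have := notS i; rewrite Du eqxx => /(_ ltac:(lia)).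
  - case: i i2 i2d Du {id} => // i i2 i2d /(f_inj (iter i f v) u) Du.
    by have := notS i; rewrite Du eqxx => /(_ ltac:(lia)).
  - by have := notS i.+1; rewrite /= -Du eqxx => /(_ ltac:(lia)).
have e_next x : dominates e x (f x) by rewrite /dominates /e eqxx orbT.
have e_prev x : dominates e (f x) x by rewrite /dominates /e eqxx !orbT.
have e_id x : dominates e x x by rewrite /dominates eqxx.
case/orP=> [i2|d2].
  by exists v; rewrite vS; case: i i2 {id} => [|[|i]] //= _.
exists (iter d f v); rewrite aS /=.
have /orP[/eqP->|/eqP->] : (d == i) || (d == i.+1) by lia.
  exact: e_id.
exact: e_prev.
Qed.

(** Positions [j - 1] to [j + 1] are dominated by [w], and positions 2 to [d - 2] are undominated so
    far; these ranges meet once the second is nonempty. *)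
Lemma playable_arc : playable e S w = (3 < d).
Proof.
case/andP: (j_lt) => j0 jd; rewrite -/d in jd.
have Dj : j = j.-1.+1 by lia.
have Dw : w = f (iter j.-1 f v) by rewrite /w Dj.
have -> : playable e S w = [|| ~~ dominated e S (iter j.-1 f v),
    ~~ dominated e S (iter j f v) | ~~ dominated e S (iter j.+1 f v)].
  apply/existsP/or3P => [[u /andP[dom ndom]]|].
    case/or3P: dom => /eqP Du.
    - by constructor 2; rewrite -/w -Du.
    - by constructor 3; rewrite /= -/w -Du.
    - by constructor 1; move: Du; rewrite Dw => /f_inj->.
  case=> ndom; [exists (iter j.-1 f v) | exists w | exists (iter j.+1 f v)];
    rewrite /w ndom andbT /dominates /e; apply/or3P.
  - by constructor 3; rewrite -/w Dw.
  - by constructor 1.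
  - by constructor 2.
rewrite !dominated_arc; lia.
Qed.

End Split.

(** * Nimber of a position as a nim-sum *)

Definition arcs_nimber S : nat :=
  \big[addb/false]_(u in S) arc_bit1 (arc S u) * 2
  + \big[addb/false]_(u in S) arc_bit0 (arc S u).

Lemma arc_sum_witness S (g : nat -> bool) :
  \big[addb/false]_(u in S) g (arc S u) -> exists2 u, u \in S & g (arc S u).
Proof.
move=> gS; apply/exists_inP; apply: contraLR gS => /exists_inPn nog.
by rewrite big1 // => u /nog/negbTE.
Qed.

Lemma arcs_nimber_move_neq S w : S != set0 -> playable e S w ->
  arcs_nimber (w |: S) != arcs_nimber S.
Proof.
move=> S0 pw; have [v [j [vS jd Dw]]] := arc_cover S w S0 (playable_notin pw).
move: pw; rewrite Dw playable_arc // => d3.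
apply/eqP => /nat_of_bits_inj[]; rewrite !arc_sum_split //.
have addb_fix (x y z : bool) : x (+) (y (+) z) = x -> y = z.
  by case: x y z => [] [] [].
by move=> /addb_fix E1 /addb_fix E0; apply: (arc_split_neq _ _ d3 jd).
Qed.

Lemma arcs_nimber_move_lt S t : t < arcs_nimber S ->
  exists2 w, playable e S w & arcs_nimber (w |: S) = t.
Proof.
rewrite /arcs_nimber.
set X1 := \big[_/_]_(u in S) arc_bit1 _; set X0 := \big[_/_]_(u in S) arc_bit0 _.
move=> lt_t; have [t1 [t0 Dt]] : exists t1 t0 : bool, t = t1 * 2 + t0.
  by exists (1 < t), (odd t); move: lt_t; case: X1 X0 => [] []; lia.
(* As in Nim, some arc has the leading digit of [t] xor the current value. *)
have [v vS lt_v] : exists2 v, v \in S &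
    (t1 (+) X1 (+) arc_bit1 (arc S v)) * 2 + (t0 (+) X0 (+) arc_bit0 (arc S v))
    < arc_bit1 (arc S v) * 2 + arc_bit0 (arc S v).
  have [E1|N1] := eqVneq t1 X1.
    have X0t : X0 by move: lt_t; rewrite Dt E1; case: X0 => //; lia.
    have t0f : t0 = false by move: lt_t; rewrite Dt E1 X0t; case: t0 {Dt} => //; lia.
    have [v vS bv] := arc_sum_witness _ _ X0t; exists v => //.
    by rewrite E1 addbb bv t0f X0t; case: arc_bit1.
  have X1t : X1.
    by move: lt_t N1; rewrite Dt; case: X1 t1 t0 X0 {Dt} => [] [] [] [].
  have [v vS bv] := arc_sum_witness _ _ X1t; exists v => //.
  move: N1; rewrite bv X1t; case: t1 {Dt} => // _.
  by case: t0 (X0) (arc_bit0 _) => [] [] [].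
have [j jd [E0 E1]] := arc_split_lt _ _ _ lt_v.
(* An arc of length at most 3 has value 0, and no value lies below it. *)
have d3 : 3 < arc S v.
  rewrite ltnNge; apply: contraL lt_v; rewrite -subn_eq0 -arc_bits => /eqP->.
  by rewrite ltn0.
exists (iter j f v); first by rewrite playable_arc.
have addb_cancel (x y z : bool) : x (+) (y (+) (z (+) x (+) y)) = z.
  by case: x y z => [] [] [].
by rewrite !arc_sum_split // E0 E1 -/X0 -/X1 !addb_cancel.
Qed.

(** The two preceding lemmas say that [arcs_nimber] obeys the mex recursion. *)
Lemma nimber_arcs S : S != set0 -> nimber e S = arcs_nimber S.
Proof.
have [m] := ubnP #|~: S|; elim: m S => // m IHm S lt_m S0.
have IHS w : playable e S w -> nimber e (w |: S) = arcs_nimber (w |: S).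
  move=> pw; apply: IHm; first by have := card_setC_playable _ _ _ _ pw; lia.
  by apply/set0Pn; exists w; rewrite !inE eqxx.
rewrite nimberE; apply: mex_eq => [|t /arcs_nimber_move_lt[w pw <-]].
  apply/mapP => -[w]; rewrite mem_enum => pw.
  by move/eqP; rewrite IHS // eq_sym (negPf (arcs_nimber_move_neq _ _ S0 pw)).
by apply/mapP; exists w; rewrite ?mem_enum ?IHS.
Qed.

Lemma arc_set1 v : arc [set v] v = #|T|.
Proof.
have Do : order f v = #|T|.
  by apply: eq_card => x; rewrite !inE f_conn.
apply: arc_eq; rewrite -?Do ?inE ?order_gt0 ?iter_order ?eqxx // => i id.
rewrite inE; apply/eqP => Dv.
(* Below the order, [findex] recovers [i]; an early return to [v] would make it 0. *)
have := findex_iter (f := f) (x := v) (i := i).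
by rewrite Dv findex0 => /(_ ltac:(lia)); lia.
Qed.

Lemma nimber_first_move v : nimber e (v |: set0) = (#|T| - 3) %% 4.
Proof.
rewrite setU0 nimber_arcs; last by apply/set0Pn; exists v; rewrite inE.
by rewrite /arcs_nimber !big_set1 arc_set1 arc_bits.
Qed.

Lemma graph_nimber_cyclic : 3 <= #|T| ->
  graph_nimber e = (if #|T| %% 4 == 3 then 1 else 0).
Proof.
move=> T3; rewrite /graph_nimber nimberE.
have p0 v : playable e set0 v.
  apply/existsP; exists v; rewrite /dominates eqxx /=.
  by apply/existsP => -[x]; rewrite inE.
(* All options share one nimber, so the mex is 1 if that nimber is 0, and 0 otherwise. *)
have mem_moves k :
    (k \in [seq nimber e (v |: set0) | v <- enum (playable e set0)])
    = (k == (#|T| - 3) %% 4).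
  apply/mapP/eqP => [[v _ ->]|->]; first exact: nimber_first_move.
  have /card_gt0P[v _] : 0 < #|T| by lia.
  by exists v; rewrite ?nimber_first_move // mem_enum; apply: p0.
by case: ifP => Dn; apply: mex_eq => [|k]; rewrite mem_moves; lia.
Qed.

End Arcs.

(** * The cycle on ['I_n] *)

Lemma val_iter_ordS n (i : 'I_n) k : iter k (@ordS n) i = (i + k) %% n :> nat.
Proof.
elim: k => [|k IHk]; first by rewrite addn0 modn_small.
by rewrite iterS /= IHk -addn1 modnDml addn1 addnS.
Qed.

Lemma fconnect_ordS n (x y : 'I_n) : fconnect (@ordS n) x y.
Proof.
(* The first [n - x] steps wrap around to 0, and [y] more reach [y]. *)
suff -> : y = iter (n - x + y) (@ordS n) x by apply: fconnect_iter.
apply: val_inj; rewrite /= val_iter_ordS addnA subnKC; last exact: ltnW.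
by rewrite modnDl modn_small.
Qed.

Theorem theorem4 (n : nat) (n_ge3 : 3 <= n) :
  graph_nimber (@cycle_rel n) = (if n %% 4 == 3 then 1 else 0) /\
  (Alice_wins (@cycle_rel n) <-> n %% 4 = 3).
Proof.
have nimE : graph_nimber (@cycle_rel n) = (if n %% 4 == 3 then 1 else 0).
  have := graph_nimber_cyclic _ (@ordS n) (can_inj (@ordSK n)) (@fconnect_ordS n).
  by rewrite card_ord; apply.
split=> //; rewrite /Alice_wins mover_winsP -/(graph_nimber _) nimE.
by case: (n %% 4 =P 3).
Qed.
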